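(* Let $H,\alpha_\ell,\alpha_g,\tau,b,\hat b>0$ and let $\rho\in\mathbb R$ with $0\le\rho<\tau$. Let the inverter transfer function be $G_{\omega_{\rm vsi},p_{\rm vsi}}(s)=k_p+\frac{k_i}{s}+k_d s$ with $$k_d=\frac{\tau\rho}{\alpha_g(\tau-\rho)}-\frac1{\hat b},\qquad k_p=\frac{\tau+\rho}{\alpha_g(\tau-\rho)},\qquad k_i=\frac1{\alpha_g(\tau-\rho)}.$$ Then the closed-loop transfer function $G^{\rm cl}_{\omega_{\rm sm},p_\ell}(s)$ is stable if either (i) $\hat b\ge b$, or (ii) $(\rho,\hat b)\in\mathcal M$, where $$\mathcal M=\Big\{(\rho,\hat b)\in\mathbb R^2:\ \hat b<b,\ \frac{\tau\alpha_g(b-\hat b)}{\tau\hat b\,b+\alpha_g(b-\hat b)}\le\rho<\tau\Big\}.$$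
   Context: Two-bus power system model. A synchronous machine with inertia constant $H>0$, load frequency sensitivity $\alpha_\ell>0$, governor gain $\alpha_g>0$ and turbine time constant $\tau>0$ has frequency deviation $\omega_{\rm sm}=-G_{\omega_{\rm sm},p_{\rm sm}}(s)\,p_{\rm sm}$, where $$G_{\omega_{\rm sm},p_{\rm sm}}(s)=\frac{1}{2Hs+\alpha_\ell+\frac{\alpha_g}{\tau s+1}}.$$ An inverter with dynamics $\omega_{\rm vsi}=-G_{\omega_{\rm vsi},p_{\rm vsi}}(s)\,p_{\rm vsi}$ is connected to it through a lossless line of susceptance $b>0$, so $p_{\rm vsi}=\frac{b}{s}(\omega_{\rm vsi}-\omega_{\rm sm})$. The power balance is $p_{\rm sm}=p_\ell-p_{\rm vsi}$, where $p_\ell$ is the load perturbation. Consequently $\omega_{\rm sm}=G^{\rm cl}_{\omega_{\rm sm},p_\ell}(s)\,p_\ell$ with $$G^{\rm cl}_{\omega_{\rm sm},p_\ell}(s)=-\frac{\big(\frac1b s+G_{\omega_{\rm vsi},p_{\rm vsi}}(s)\big)G_{\omega_{\rm sm},p_{\rm sm}}(s)}{\frac1b s+G_{\omega_{\rm sm},p_{\rm sm}}(s)+G_{\omega_{\rm vsi},p_{\rm vsi}}(s)}.$$ The parameter $\hat b$ is the (possibly inexact) estimate of the true susceptance $b$ used in the controller, and $\rho$ is the desired effective turbine time constant. Convention. Transfer functions are real rational functions of $s$ taken in reduced form; a transfer function is stable if all its poles have strictly negative real part. *)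

(* Defs.v *)
From mathcomp Require Import all_boot all_order all_algebra.
From mathcomp Require Import generic_quotient fraction.
From mathcomp Require Import complex.
From mathcomp Require Import classical_sets reals.

Set Implicit Arguments.
Unset Strict Implicit.
Unset Printing Implicit Defensive.

Import Order.TTheory GRing.Theory Num.Theory.
Local Open Scope ring_scope.

Notation "x %:F" := (@FracField.tofrac _ x) : ring_scope.

Section TransferFunctions.
Variable R : realType.

Definition transfer_function := {fraction {poly R}}.

Implicit Type G : transfer_function.

Definition tf_s : transfer_function := 'X%:F.
Definition tf_const (a : R) : transfer_function := (a%:P)%:F.

(* [repr G] is some fraction representing [G], not necessarily in lowest terms;
   dividing by the gcd puts it in reduced form (see [tf_reduced]). *)
Definition tf_num G : {poly R} :=
  \n_(repr G) %/ gcdp \n_(repr G) \d_(repr G).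
Definition tf_den G : {poly R} :=
  \d_(repr G) %/ gcdp \n_(repr G) \d_(repr G).

Definition is_pole G (z : R[i]) : Prop :=
  root (map_poly (real_complex R) (tf_den G)) z.

Definition stable G : Prop := forall z : R[i], is_pole G z -> complex.Re z < 0.

Lemma tf_fracE G : G = (\n_(repr G))%:F / (\d_(repr G))%:F.
Proof.
have d0 : (\d_(repr G))%:F != 0 :> transfer_function.
  by rewrite tofrac_eq0 denom_ratioP.
apply: (mulIf d0); rewrite divfK // -{1}[G]reprK.
rewrite !piE; apply/eqP; rewrite FracField.equivf_def /= /FracField.mulf.
by rewrite !numden_Ratio ?mulr1 ?oner_neq0 ?denom_ratioP // mulrC.
Qed.

Lemma tf_reduced G :
  [/\ coprimep (tf_num G) (tf_den G), tf_den G != 0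
    & G = (tf_num G)%:F / (tf_den G)%:F].
Proof.
have d0 := denom_ratioP (repr G).
have g0 : gcdp \n_(repr G) \d_(repr G) != 0.
  by rewrite gcdp_eq0 negb_and d0 orbT.
have nE := divpK (dvdp_gcdl \n_(repr G) \d_(repr G)).
have dE := divpK (dvdp_gcdr \n_(repr G) \d_(repr G)).
split; first by apply: coprimep_div_gcd; rewrite d0 orbT.
  by apply: contra_neq d0 => dG0; rewrite -dE -/(tf_den G) dG0 mul0r.
have gF0 : (gcdp \n_(repr G) \d_(repr G))%:F != 0 :> transfer_function.
  by rewrite tofrac_eq0.
rewrite [LHS]tf_fracE -[X in X%:F / _]nE -[X in _ / X%:F]dE !tofracM.
by rewrite -mulf_div divff ?mulr1.
Qed.

Lemma tf_den_uniq G (n d : {poly R}) :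
  d != 0 -> coprimep n d -> G = n%:F / d%:F -> tf_den G %= d.
Proof.
move=> d0 cnd GE; have [cG dG0 GE'] := tf_reduced G.
have E : n * tf_den G = tf_num G * d.
  apply/eqP; rewrite -tofrac_eq !tofracM -eqr_div ?tofrac_eq0 //.
  by rewrite -GE -GE'.
apply/andP; split.
  by rewrite -(Gauss_dvdpr d (q := tf_num G)) 1?coprimep_sym // -E dvdp_mull.
by rewrite -(Gauss_dvdpr _ (q := n)) 1?coprimep_sym // E dvdp_mull.
Qed.

End TransferFunctions.

Section TwoBusSystem.
Variable R : realType.
Local Notation s := (tf_s R).
Local Notation "a %:TF" := (tf_const a) (at level 2, format "a %:TF").

Definition G_sm (H alphal alphag tau : R) : transfer_function R :=
  1 / ((2 * H)%:TF * s + alphal%:TF + alphag%:TF / (tau%:TF * s + 1)).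

Definition G_pid (kp ki kd : R) : transfer_function R :=
  kp%:TF + ki%:TF / s + kd%:TF * s.

Definition G_cl (b : R) (Gsm Gvsi : transfer_function R) : transfer_function R :=
  - (((b^-1)%:TF * s + Gvsi) * Gsm / ((b^-1)%:TF * s + Gsm + Gvsi)).

Definition k_d (alphag tau rho bhat : R) : R :=
  tau * rho / (alphag * (tau - rho)) - 1 / bhat.
Definition k_p (alphag tau rho : R) : R :=
  (tau + rho) / (alphag * (tau - rho)).
Definition k_i (alphag tau rho : R) : R :=
  1 / (alphag * (tau - rho)).

Definition param_set (alphag tau b : R) : set (R * R) :=
  [set x : R * R | let: (rho, bhat) := x in
    bhat < b /\
    tau * alphag * (b - bhat) / (tau * bhat * b + alphag * (b - bhat))
      <= rho < tau]%classic.

End TwoBusSystem.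

(* Main.v *)
(* Either condition on [bhat] gives [a = 1/b + k_d >= 0].  Then
   [s/b + G_vsi = a s + k_p + k_i/s] has nonnegative real part for [Re s >= 0],
   [s <> 0], while [G_sm] has positive real part there, so their sum, the
   denominator of [G_cl], has no zero in the closed right half-plane; [s = 0] is
   not a pole of [G_cl] because [k_i (alphal + alphag) > 0]. *)
Require Import Defs.
From mathcomp Require Import all_boot all_order all_algebra.
From mathcomp Require Import classical_sets reals.
From mathcomp Require Import fraction complex ring lra.
Import Order.TTheory GRing.Theory Num.Theory.
Local Open Scope ring_scope.
Set Implicit Arguments.
Unset Strict Implicit.

(* No coprimality of [n] and [d]: for the closed loop with [bhat = b] they share
   the factor [tau s + 1]. *)
Lemma is_pole_root (R : realType) (G : transfer_function R) (n d : {poly R})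
    (z : R[i]) :
  d != 0 -> G = n%:F / d%:F -> is_pole G z ->
  root (map_poly (real_complex R) d) z.
Proof.
move=> d0 GE; have [cG dG0 GE'] := tf_reduced G.
have E : n * tf_den G = tf_num G * d.
  apply/eqP; rewrite -tofrac_eq !tofracM -eqr_div ?tofrac_eq0 //.
  by rewrite -GE -GE'.
have /dvdpP[c ->] : tf_den G %| d.
  by rewrite -(Gauss_dvdpr d (q := tf_num G)) 1?coprimep_sym // -E dvdp_mull.
by rewrite rmorphM rootM => ->; rewrite orbT.
Qed.

(** If [u * v] were [- r], multiplying by the conjugate of [v] would give [u] times |v|^2 equal to
    [- r] times that conjugate; the real parts then have opposite signs. *)
Lemma Re_gt0_mul_neq_npos (R : rcfType) (u v : R[i]) (r : R) :
  0 < complex.Re u -> 0 < complex.Re v -> 0 <= r -> u * v != (- r)%:C%C.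
Proof.
case: u v => [u1 u2] [v1 v2] /= u1_gt0 v1_gt0 r_ge0.
apply/eqP => -[re_uv im_uv].
have : u1 * (v1 ^+ 2 + v2 ^+ 2) = - r * v1.
  by rewrite -[RHS]addr0 -(mulr0 v2) -re_uv -im_uv; ring.
have : 0 < u1 * (v1 ^+ 2 + v2 ^+ 2).
  by rewrite mulr_gt0 ?ltr_pwDl ?exprn_gt0 ?sqr_ge0.
have : 0 <= r * v1 by rewrite mulr_ge0 // ltW.
by lra.
Qed.

(** The line and inverter term s/b + G_vsi is this polynomial over s, where [a] stands for 1/b +
    k_d. *)
Definition pid_line_num (R : realType) (a kp ki : R) : {poly R} :=
  a%:P * 'X ^+ 2 + kp%:P * 'X + ki%:P.

Definition turbine_den (R : realType) (tau : R) : {poly R} := tau%:P * 'X + 1.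

(** [G_sm] is [turbine_den] over this polynomial. *)
Definition sm_den (R : realType) (H alphal alphag tau : R) : {poly R} :=
  ((2 * H)%:P * 'X + alphal%:P) * turbine_den tau + alphag%:P.

(** Numerator of s/b + G_sm + G_vsi over the common denominator s times [sm_den]. *)
Definition cl_den (R : realType) (H alphal alphag tau a kp ki : R) : {poly R} :=
  pid_line_num a kp ki * sm_den H alphal alphag tau + 'X * turbine_den tau.

Lemma cl_den_root_Re_lt0 (R : realType) (H alphal alphag tau a kp ki : R)
    (z : R[i]) :
  0 < H -> 0 < alphal -> 0 < alphag -> 0 < tau ->
  0 <= a -> 0 < kp -> 0 < ki ->
  root (map_poly (real_complex R) (cl_den H alphal alphag tau a kp ki)) z ->
  complex.Re z < 0.
Proof.
move=> H0 al0 ag0 tau0 a0 kp0 ki0.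
case: z => x y; rewrite /root /cl_den /pid_line_num /sm_den /turbine_den.
rewrite !(rmorphD, rmorphM, rmorphXn, rmorph1) /=.
rewrite !(map_polyX, map_polyC) /=.
rewrite !(hornerD, hornerM, hornerXn, hornerX, hornerC).
set z := Complex x y => /eqP cl0; case: ltP => // x_ge0.
set u := (_ * z ^+ 2 + _ + _) in cl0; set v := (_ + alphag%:C%C) in cl0.
set w := (tau%:C%C * z + 1) in v cl0.
(* Multiplying the factors of [u v = - z w] by the conjugates of [z] and [w]
   makes the real parts of [u / z] and [v / w] visible without division. *)
pose zc := Complex x (- y); pose wc := Complex (tau * x + 1) (- (tau * y)).
have wE : w = Complex (tau * x + 1) (tau * y).
  by rewrite /w /z; simpc.
pose r := (x ^+ 2 + y ^+ 2) * ((tau * x + 1) ^+ 2 + (tau * y) ^+ 2).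
have w1_gt0 : 0 < tau * x + 1 by rewrite ltr_wpDl ?mulr_ge0 ?(ltW tau0).
have Re_u : complex.Re (u * zc) = (a * x + kp) * (x ^+ 2 + y ^+ 2) + ki * x.
  by rewrite /u /zc /z expr2; simpc => /=; ring.
have Re_v : complex.Re (v * wc) =
    (2 * H * x + alphal) * ((tau * x + 1) ^+ 2 + (tau * y) ^+ 2) +
      alphag * (tau * x + 1).
  by rewrite /v wE /wc /z; simpc => /=; ring.
have Re_v_gt0 : 0 < complex.Re (v * wc).
  rewrite Re_v ltr_pwDr ?mulr_gt0 // mulr_ge0 ?addr_ge0 ?sqr_ge0 //.
    by rewrite !mulr_ge0 // ltW.
  exact: ltW.
(* At [z = 0] the real part in [Re_u] vanishes, but there [cl0] reads
   [ki * (alphal + alphag) = 0]. *)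
have [z0|z_neq0] := eqVneq z 0.
  move: cl0; rewrite /v /u /w z0 expr0n /= !mulr0 mul0r !add0r addr0 mulr1.
  move=> /eqP; rewrite -rmorphD -rmorphM /= fmorph_eq0.
  by rewrite (gt_eqF (mulr_gt0 ki0 (addr_gt0 al0 ag0))).
have z_norm_gt0 : 0 < x ^+ 2 + y ^+ 2.
  rewrite lt_def addr_ge0 ?sqr_ge0 // andbT paddr_eq0 ?sqr_ge0 // !sqrf_eq0.
  by apply: contra z_neq0 => /andP[/eqP x0 /eqP y0]; rewrite /z x0 y0.
have Re_u_gt0 : 0 < complex.Re (u * zc).
  rewrite Re_u ltr_wpDr ?mulr_ge0 ?(ltW ki0) // mulr_gt0 //.
  by rewrite ltr_wpDl // mulr_ge0.
have r_ge0 : 0 <= r by rewrite mulr_ge0 ?addr_ge0 ?sqr_ge0.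
(* By [cl0], the product of [u * zc] and [v * wc] is - |z|^2 |w|^2, that is [- r]. *)
have /eqP[] := Re_gt0_mul_neq_npos Re_u_gt0 Re_v_gt0 r_ge0.
have -> : (- r)%:C%C = - ((z * zc) * (w * wc)).
  by rewrite wE /z /zc /wc /r; simpc; congr Complex; ring.
rewrite -[LHS]subr0 -(mul0r (zc * wc)) -cl0; ring.
Qed.

(** Over an abstract field, [field] handles the entries as atoms. Here [h] stands for 2H and [b] for
    the inverse of the susceptance. *)
Lemma G_cl_field_identity (F : fieldType) (h l g t b p i d x : F) :
  let w := t * x + 1 in let D := (h * x + l) * w + g in
  let N := (b + d) * x ^+ 2 + p * x + i in
  x != 0 -> w != 0 -> D != 0 -> N * D + x * w != 0 ->
  - ((b * x + (p + i / x + d * x)) * (1 / (h * x + l + g / w)) /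
     (b * x + 1 / (h * x + l + g / w) + (p + i / x + d * x))) =
  - (N * w) / (N * D + x * w).
Proof.
move=> w D N x0 w0 D0 d0.
have -> : h * x + l + g / w = D / w by rewrite /D; field.
have -> : b * x + (p + i / x + d * x) = N / x by rewrite /N; field.
have -> : b * x + 1 / (D / w) + (p + i / x + d * x) = (N * D + x * w) / (x * D).
  by rewrite /N; field; rewrite x0 D0.
by field; rewrite x0 D0 d0 w0.
Qed.

Lemma G_cl_fracE (R : realType) (H alphal alphag tau b kp ki kd : R) :
  0 < alphal -> 0 < alphag -> 0 < ki ->
  let d := cl_den H alphal alphag tau (b^-1 + kd) kp ki in
  d != 0 /\
  G_cl b (G_sm H alphal alphag tau) (G_pid kp ki kd) =
  (- (pid_line_num (b^-1 + kd) kp ki * turbine_den tau))%:F / d%:F.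
Proof.
move=> al0 ag0 ki0 d.
(* Each denominator is nonzero because its constant term is positive: 1, [alphal + alphag] and
   [ki * (alphal + alphag)] respectively. *)
have nz (p : {poly R}) : 0 < p.[0] -> p%:F != 0 :> transfer_function R.
  rewrite tofrac_eq0; apply: contraTneq => ->; by rewrite horner0 ltxx.
have s0 : 'X%:F != 0 :> transfer_function R by rewrite tofrac_eq0 polyX_eq0.
have t0 : (turbine_den tau)%:F != 0 by apply: nz; rewrite /turbine_den !hornerE.
have D0 : (sm_den H alphal alphag tau)%:F != 0.
  apply: nz; rewrite /sm_den /turbine_den !hornerE /=.
  by rewrite ?mulr0 ?add0r ?mulr1 addr_gt0.
have d0 : d%:F != 0.
  apply: nz; rewrite /d /cl_den /pid_line_num /sm_den /turbine_den !hornerE /=.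
  by rewrite ?expr0n ?mulr0 ?mul0r ?add0r ?addr0 ?mulr1 mulr_gt0 ?addr_gt0.
split; first by rewrite -tofrac_eq0.
move: t0 D0 d0; rewrite /G_cl /G_sm /G_pid /tf_const /tf_s.
rewrite /d /cl_den /pid_line_num /sm_den /turbine_den.
rewrite !(tofracN, tofracD, tofracM, tofracXn, tofrac1, polyCD).
exact: G_cl_field_identity.
Qed.

Theorem theorem1 (R : realType) (H alphal alphag tau b bhat rho : R)
    (hH : 0 < H) (halphal : 0 < alphal) (halphag : 0 < alphag)
    (htau : 0 < tau) (hb : 0 < b) (hbhat : 0 < bhat)
    (hrho : 0 <= rho < tau) :
  (b <= bhat \/ param_set alphag tau b (rho, bhat)) ->
  stable (G_cl b (G_sm H alphal alphag tau)
    (G_pid (k_p alphag tau rho) (k_i alphag tau rho)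
       (k_d alphag tau rho bhat))).
Proof.
case/andP: hrho => rho_ge0 rho_lt hM z.
have c_gt0 : 0 < alphag * (tau - rho) by rewrite mulr_gt0 ?subr_gt0.
have ki_gt0 : 0 < k_i alphag tau rho by rewrite divr_gt0.
have kp_gt0 : 0 < k_p alphag tau rho by rewrite divr_gt0 // ltr_pwDl.
have a_ge0 : 0 <= b^-1 + k_d alphag tau rho bhat.
  case: hM => [b_le|[bhat_lt /andP[rho_ge _]]].
    have kd_ge0 : 0 <= tau * rho / (alphag * (tau - rho)).
      exact: divr_ge0 (mulr_ge0 (ltW htau) rho_ge0) (ltW c_gt0).
    have : bhat^-1 <= b^-1 by rewrite lef_pV2.
    by rewrite /k_d; lra.
  (* Over a common denominator, the numerator is nonnegative exactly when [rho] satisfies the lower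
     bound in [param_set]. *)
  have -> : b^-1 + k_d alphag tau rho bhat =
      (rho * (tau * bhat * b + alphag * (b - bhat)) - tau * alphag * (b - bhat))
      / (alphag * (tau - rho) * (b * bhat)).
    by rewrite /k_d; field; rewrite !gt_eqF ?subr_gt0.
  rewrite divr_ge0 ?(ltW (mulr_gt0 c_gt0 (mulr_gt0 hb hbhat))) //.
  rewrite subr_ge0 -ler_pdivrMr //.
  by rewrite addr_gt0 ?mulr_gt0 ?subr_gt0.
have [d_neq0 GE] := G_cl_fracE H tau b (k_p alphag tau rho)
  (k_d alphag tau rho bhat) halphal halphag ki_gt0.
by move/(is_pole_root d_neq0 GE); apply: cl_den_root_Re_lt0.
Qed.
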